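(* Let $k^2$ be a constant and consider the system $$u_t+(u^2)_x=\sigma_x,\qquad \sigma_t+u\sigma_x=k^2u_x.$$ For any integer $p$ there is a solution of this system up to $e^{-p}$ in the sense of $\mathbf{R}\langle\varepsilon\rangle$-distributions of the form $$u(t,x,\varepsilon)=u_0+\Delta u\,U\!\left(\frac{x-vt}{\varepsilon}\right),\qquad \sigma(t,x,\varepsilon)=\sigma_0+\Delta\sigma\,\Sigma\!\left(\frac{x-vt}{\varepsilon}\right),$$ where $u_0,\Delta u,\sigma_0,\Delta\sigma,v$ are real, $\Delta u\ne0$, $\Delta\sigma\neq0$, $U(x)=\int_{-\infty}^x\widetilde U(y)\,dy$, $\Sigma(x)=\int_{-\infty}^x\widetilde\Sigma(y)\,dy$ with $\widetilde U,\widetilde\Sigma\in\mathcal{S}(\mathbf{R})$ and $\int\widetilde U=\int\widetilde\Sigma=1$; that is, for every $t\in[0,T]$ and every $\psi\in\mathcal{S}(\mathbf{R})$, $$\int_{-\infty}^{+\infty}\{u_t+2uu_x-\sigma_x\}\psi(x)\,dx=\sum_{k=p}^{\infty}\xi_k\varepsilon^k,\qquad \int_{-\infty}^{+\infty}\{\sigma_t+u\sigma_x-k^2u_x\}\psi(x)\,dx=\sum_{k=p}^{\infty}\eta_k\varepsilon^k$$ in $\mathbf{R}\langle\varepsilon\rangle$. Moreover, $$v=2u_0+\Delta u-\frac{\Delta\sigma}{\Delta u},\qquad (\Delta\sigma)^2-\left(u_0+\tfrac12\Delta u\right)\Delta u\,\Delta\sigma-k^2(\Delta u)^2=0.$$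
   Context: $\mathbf{R}\langle\varepsilon\rangle$ is the field of formal Laurent series $\sum_{n\ge 0}\xi_{n+k}\varepsilon^{n+k}$ ($k\in\mathbf{Z}$, $\xi_i\in\mathbf{R}$) with the non-Archimedean norm $|x|_\nu=e^{-\nu(x)}$, where $\nu(x)$ is the lowest exponent with nonzero coefficient. Integrals depending on $\varepsilon\in(0,1]$ are regarded as elements of $\mathbf{R}\langle\varepsilon\rangle$ via their expansions in powers of $\varepsilon$; ''up to $e^{-p}$'' means these elements only contain powers $\varepsilon^k$ with $k\ge p$. $T>0$ is a fixed time horizon and $\mathcal{S}(\mathbf{R})$ is the Schwartz space. Here $u$ is the velocity of a medium (of density 1) and $\sigma$ the stress. *)

(* Defs.v *)
From Stdlib Require Import Reals ZArith.
From Coquelicot Require Import Coquelicot.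
Open Scope R_scope.

Definition schwartz (f : R -> R) : Prop :=
  (forall (n : nat) (x : R), ex_derive_n f n x) /\
  (forall m n : nat, exists C : R, forall x : R,
      Rabs (x ^ m * Derive_n f n x) <= C).

Definition is_int_R (f : R -> R) (l : R) : Prop :=
  is_RInt_gen f (Rbar_locally m_infty) (Rbar_locally p_infty) l.

Definition is_primitive_from_minf (f F : R -> R) : Prop :=
  forall x : R, is_RInt_gen f (Rbar_locally m_infty) (at_point x) (F x).

(* A function of eps in (0,1], viewed as an element of R<eps> through its
   expansion in powers of eps, only contains powers eps^k with k >= p:
   I(eps) = sum_{k>=p} xi_k eps^k as an asymptotic expansion at eps -> 0+. *)
Definition expansion_from (p : Z) (I : R -> R) : Prop :=
  exists xi : nat -> R, forall N : nat,
    exists delta C : R, 0 < delta /\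
      forall eps : R, 0 < eps <= delta ->
        Rabs (I eps - sum_f_R0 (fun n => xi n * powerRZ eps (p + Z.of_nat n)) N)
          <= C * powerRZ eps (p + Z.of_nat N + 1).

Definition wave (c0 d : R) (W : R -> R) (v eps t x : R) : R :=
  c0 + d * W ((x - v * t) / eps).

Definition residual1 (u s : R -> R -> R) (t x : R) : R :=
  Derive (fun t' => u t' x) t + 2 * u t x * Derive (fun y => u t y) x
  - Derive (fun y => s t y) x.

Definition residual2 (k : R) (u s : R -> R -> R) (t x : R) : R :=
  Derive (fun t' => s t' x) t + u t x * Derive (fun y => s t y) x
  - k ^ 2 * Derive (fun y => u t y) x.

Definition weak_residual_from (p : Z) (res : R -> R -> R -> R) (t : R)
  (psi : R -> R) : Prop :=
  exists I : R -> R,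
    (forall eps : R, 0 < eps <= 1 ->
       is_int_R (fun x => res eps t x * psi x) (I eps)) /\
    expansion_from p I.

(* Main.v *)
Require Import Defs.
From Stdlib Require Import Reals ZArith Lra Lia.
From Coquelicot Require Import Coquelicot.
Open Scope R_scope.

(** With y = (x - vt)/eps, both residuals have the form F(y)/eps, so by Taylor
    expansion of psi at vt the coefficient of eps^j is the j-th moment of F
    times psi^(j)(vt)/j!; it suffices that the moments of F below some P >= p
    vanish.  Take U the logistic function, Ut = U (1 - U) and du = ds = 1,
    u0 = 1/2 - k^2, v = 2 u0.  Then F is 2 U Ut - St for the first equation and
    (k^2 - 1/2 + U) St - k^2 Ut for the second, so the conditions are linear in
    St: they prescribe the integrals of y^j St and y^j U St for j < P.  The jump
    relations encode the case j = 0, where the integrals are 1 and 1/2.  Such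
    an St exists by Gram-Schmidt with weight Ut, because the functions y^j and
    y^j U are linearly independent: ordered as U, y U, y^2 U, ..., 1, y, y^2, ...,
    each one outgrows its predecessors at -oo. *)

(** * Integrals over the line *)

(** The majorant has the explicit bounded primitive C * atan, so convergence at both ends reduces to
    the Cauchy property of atan there. *)
Definition dominated (f : R -> R) : Prop :=
  (forall x : R, continuous f x) /\
  exists C : R, forall x : R, Rabs (f x) <= C * / (1 + x ^ 2).

Lemma continuous_ex_RInt (f : R -> R) (a b : R) :
  (forall x : R, continuous f x) -> ex_RInt f a b.
Proof. intros H; apply (@ex_RInt_continuous R_CompleteNormedModule); intros; apply H. Qed.

Lemma is_RInt_dominating (C a b : R) :
  is_RInt (fun x => C * / (1 + x ^ 2)) a b (C * atan b - C * atan a).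
Proof.
  apply (is_RInt_derive (fun x => C * atan x)).
  - intros x _. evar_last. apply is_derive_scal. apply is_derive_atan.
    rewrite <- Rsqr_pow2. reflexivity.
  - intros x _. apply (ex_derive_continuous (fun x => C * / (1 + x ^ 2))).
    auto_derive. nra.
Qed.

(** Absolute values on both sides make the bound independent of the order of a and b; the Cauchy
    criterion supplies two points in no particular order. *)
Lemma dominated_RInt_le (f : R -> R) (C a b : R) :
  (forall x : R, continuous f x) ->
  (forall x : R, Rabs (f x) <= C * / (1 + x ^ 2)) ->
  Rabs (RInt f a b) <= C * Rabs (atan b - atan a).
Proof.
  intros Hc HC.
  assert (H : forall a b, a <= b -> Rabs (RInt f a b) <= C * (atan b - atan a)).
  { intros a' b' ab. rewrite Rmult_minus_distr_l.
    apply (norm_RInt_le f (fun x => C * / (1 + x ^ 2)) a' b'); auto.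
    - apply (RInt_correct f), continuous_ex_RInt, Hc.
    - apply is_RInt_dominating. }
  assert (C0 : 0 <= C).
  { generalize (HC 0) (Rabs_pos (f 0)). replace (C * / (1 + 0 ^ 2)) with C by field. lra. }
  assert (Hm : forall a b, a <= b -> atan a <= atan b).
  { intros a' b' [h | ->]; [left; apply atan_increasing | right]; auto. }
  destruct (Rle_dec a b) as [ab | ab].
  - rewrite (Rabs_pos_eq (atan b - atan a)). now apply H. generalize (Hm _ _ ab); lra.
  - assert (ba : b <= a) by lra.
    rewrite <- (opp_RInt_swap f) by (now apply continuous_ex_RInt).
    change (opp (RInt f b a)) with (- RInt f b a). rewrite Rabs_Ropp.
    rewrite Rabs_minus_sym, (Rabs_pos_eq (atan a - atan b)).
    now apply H. generalize (Hm _ _ ba); lra.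
Qed.

Lemma atan_cauchy (z : Rbar) (eps : posreal) :
  z = p_infty \/ z = m_infty ->
  exists P : R -> Prop, Rbar_locally z P /\
    forall x y : R, P x -> P y -> Rabs (atan y - atan x) < eps.
Proof.
  intros Hz.
  (* The cap PI / 4 keeps PI / 2 - e and e - PI / 2 in the interval where atan inverts tan. Beyond
     those tangents, atan stays within e <= eps / 2 of its limit. *)
  set (e := Rmin (eps / 2) (PI / 4)).
  assert (e0 : 0 < e <= eps / 2 /\ e <= PI / 4).
  { unfold e. generalize (cond_pos eps) PI_RGT_0; intros.
    unfold Rmin; destruct Rle_dec; lra. }
  destruct Hz as [-> | ->].
  - exists (fun x => tan (PI / 2 - e) < x). split.
    + now exists (tan (PI / 2 - e)).
    + intros x y hx hy. apply atan_increasing in hx. apply atan_increasing in hy.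
      rewrite atan_tan in hx, hy by lra.
      generalize (atan_bound x) (atan_bound y); intros.
      apply Rabs_def1; lra.
  - exists (fun x => x < tan (e - PI / 2)). split.
    + now exists (tan (e - PI / 2)).
    + intros x y hx hy. apply atan_increasing in hx. apply atan_increasing in hy.
      rewrite atan_tan in hx, hy by lra.
      generalize (atan_bound x) (atan_bound y); intros.
      apply Rabs_def1; lra.
Qed.

Lemma dominated_RInt_lim (f : R -> R) (z : Rbar) :
  dominated f -> z = p_infty \/ z = m_infty ->
  exists l : R, filterlim (RInt f 0) (Rbar_locally z) (locally l).
Proof.
  intros [Hc [C HC]] Hz.
  apply (filterlim_locally_cauchy (F := Rbar_locally z) (U := R_CompleteSpace)).
  intros eps.
  (* Dividing eps by |C| + 1 rather than by C avoids a possible zero denominator. *)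
  assert (C0 : 0 < Rabs C + 1) by (generalize (Rabs_pos C); lra).
  destruct (atan_cauchy z (mkposreal _ (Rdiv_lt_0_compat _ _ (cond_pos eps) C0)) Hz)
    as [P [HP HPe]].
  exists P; split; auto. intros x y Hx Hy.
  specialize (HPe x y Hx Hy). simpl in HPe.
  change (Rabs (RInt f 0 y - RInt f 0 x) < eps).
  replace (RInt f 0 y - RInt f 0 x) with (RInt f x y).
  2:{ generalize (RInt_Chasles f 0 x y (continuous_ex_RInt f 0 x Hc) (continuous_ex_RInt f x y Hc)).
      intros H. change (RInt f 0 x + RInt f x y = RInt f 0 y) in H. lra. }
  eapply Rle_lt_trans. apply (dominated_RInt_le f C); auto.
  apply Rle_lt_trans with ((Rabs C + 1) * Rabs (atan y - atan x)).
  - apply Rmult_le_compat_r. apply Rabs_pos. generalize (Rle_abs C); lra.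
  - apply (Rmult_lt_compat_l _ _ _ C0) in HPe.
    replace ((Rabs C + 1) * (eps / (Rabs C + 1))) with (pos eps) in HPe by (field; lra).
    exact HPe.
Qed.

Lemma is_derive_RInt0 (f : R -> R) (x : R) :
  (forall x : R, continuous f x) -> is_derive (RInt f 0) x (f x).
Proof.
  intros Hc. apply (is_derive_RInt f (RInt f 0) 0 x); [| apply Hc].
  apply filter_forall. intros y. apply (RInt_correct f), continuous_ex_RInt, Hc.
Qed.

(** Arbitrary end filters let this serve both integrals over the whole line and integrals from -oo
    to a point, where one filter is [at_point x]. *)
Lemma is_RInt_gen_of_primitive (f F : R -> R) (Fa Fb : (R -> Prop) -> Prop)
  (FFa : ProperFilter Fa) (FFb : ProperFilter Fb) (la lb : R) :
  (forall x : R, continuous f x) -> (forall x : R, is_derive F x (f x)) ->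
  filterlim F Fa (locally la) -> filterlim F Fb (locally lb) ->
  is_RInt_gen f Fa Fb (lb - la).
Proof.
  intros Hc HF Ha Hb.
  assert (E : forall x, Derive F x = f x) by (intros; now apply is_derive_unique).
  apply (is_RInt_gen_ext (Derive F)).
  - apply filter_forall. intros ab x _. apply E.
  - apply is_RInt_gen_Derive; auto; apply filter_forall; intros ab x _.
    + exists (f x). apply HF.
    + apply (continuous_ext f); auto.
Qed.

Definition Int_R (f : R -> R) : R :=
  RInt_gen f (Rbar_locally m_infty) (Rbar_locally p_infty).

Lemma dominated_integrable (f : R -> R) : dominated f -> is_int_R f (Int_R f).
Proof.
  intros Hf.
  destruct (dominated_RInt_lim f p_infty) as [B HB]; auto.
  destruct (dominated_RInt_lim f m_infty) as [A HA]; auto.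
  assert (H : is_int_R f (B - A)).
  { apply (is_RInt_gen_of_primitive f (RInt f 0)); auto; try apply Hf;
     try apply Rbar_locally_filter.
    intros x. apply is_derive_RInt0, Hf. }
  unfold is_int_R, Int_R in *. now rewrite (is_RInt_gen_unique f (B - A) H).
Qed.

Lemma dominated_primitive (f : R -> R) :
  dominated f -> exists F : R -> R,
    is_primitive_from_minf f F /\ forall x : R, is_derive F x (f x).
Proof.
  intros Hf.
  destruct (dominated_RInt_lim f m_infty) as [A HA]; auto.
  exists (fun x => RInt f 0 x - A). split.
  - intros x. apply is_RInt_gen_of_primitive with (RInt f 0); auto; try apply Hf;
      try apply Rbar_locally_filter; try apply at_point_filter.
    + intros y. apply is_derive_RInt0, Hf.
    + intros P HP. now apply locally_singleton in HP.
  - intros x. replace (f x) with (f x - 0) by ring.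
    apply (is_derive_minus (RInt f 0) (fun _ => A) x (f x) 0).
    apply is_derive_RInt0, Hf. apply (is_derive_const A).
Qed.

Lemma is_int_R_scal (f : R -> R) (a l : R) :
  is_int_R f l -> is_int_R (fun x => a * f x) (a * l).
Proof. exact (is_RInt_gen_scal f a l). Qed.

Lemma is_int_R_lin (f g : R -> R) (a b l m : R) :
  is_int_R f l -> is_int_R g m -> is_int_R (fun x => a * f x + b * g x) (a * l + b * m).
Proof.
  intros Hf Hg.
  exact (is_RInt_gen_plus _ _ _ _ (is_int_R_scal f a l Hf) (is_int_R_scal g b m Hg)).
Qed.

Lemma is_int_R_ext (f g : R -> R) (l : R) :
  (forall x, f x = g x) -> is_int_R f l -> is_int_R g l.
Proof. intros E. apply is_RInt_gen_ext, filter_forall. intros; apply E. Qed.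

Lemma is_int_R_unique (f : R -> R) (l m : R) : is_int_R f l -> is_int_R f m -> l = m.
Proof.
  intros Hl Hm. rewrite <- (is_RInt_gen_unique _ _ Hl). now apply is_RInt_gen_unique.
Qed.

Lemma is_int_R_Rabs_le (f g : R -> R) (l m : R) :
  (forall x, Rabs (f x) <= g x) -> is_int_R f l -> is_int_R g m -> Rabs l <= m.
Proof.
  intros H. apply (RInt_gen_norm f g).
  - exists (fun x => x < 0) (fun x => 0 < x).
    now exists 0. now exists 0. simpl; intros; lra.
  - apply filter_forall. intros ab x _. apply H.
Qed.

(** The substitution y = (x - c) / e is made on bounded intervals; the thresholds M and N for y
    become e M + c and e N + c for x. *)
Lemma is_int_R_rescale (f : R -> R) (l c e : R) :
  0 < e -> is_int_R f l -> is_int_R (fun x => / e * f ((x - c) / e)) l.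
Proof.
  intros e0 Hf P HP. destruct (Hf P HP) as [A1 B1 [M HM] [N HN] HQR].
  exists (fun x => x < e * M + c) (fun x => e * N + c < x).
  - now exists (e * M + c).
  - now exists (e * N + c).
  - intros x y Hx Hy.
    destruct (HQR ((x - c) / e) ((y - c) / e)) as [z [Hz Pz]].
    + apply HM. apply Rlt_div_l; lra.
    + apply HN. apply Rlt_div_r; lra.
    + exists z; split; auto. simpl in Hz |- *.
      apply (is_RInt_ext (fun x => scal (/ e) (f (/ e * x + - c / e)))).
      { intros t _. unfold scal; simpl; unfold mult; simpl. f_equal. f_equal. field. lra. }
      apply (is_RInt_comp_lin f (/ e) (- c / e) x y z).
      replace (/ e * x + - c / e) with ((x - c) / e) by (field; lra).
      replace (/ e * y + - c / e) with ((y - c) / e) by (field; lra).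
      exact Hz.
Qed.

(** The integral over [M - 1, M] is some r0 > 0. A large interval containing it has integral at
    least r0 and less than r0 away from l, which forces l > 0. *)
Lemma is_int_R_gt_0 (f : R -> R) (l M : R) :
  (forall x, continuous f x) -> (forall x, 0 <= f x) -> (forall x, x < M -> 0 < f x) ->
  is_int_R f l -> 0 < l.
Proof.
  intros Hc H0 HM Hl.
  assert (r0 : 0 < RInt f (M - 1) M).
  { apply RInt_gt_0; auto. lra. intros; apply HM; lra. }
  destruct (Hl (ball l (mkposreal _ r0))) as [A1 B1 [A HA] [B HB] HQR].
  { apply locally_ball. }
  set (a := Rmin A (M - 1) - 1). set (b := Rmax B M + 1).
  assert (ha : a < A /\ a < M - 1).
  { unfold a; generalize (Rmin_l A (M-1)) (Rmin_r A (M-1)); lra. }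
  assert (hb : B < b /\ M < b).
  { unfold b; generalize (Rmax_l B M) (Rmax_r B M); lra. }
  destruct (HQR a b) as [z [Hz Pz]]. now apply HA. now apply HB.
  simpl in Hz. apply (is_RInt_unique f a b (z : R_CompleteNormedModule)) in Hz. subst z.
  change (Rabs (RInt f a b - l) < RInt f (M - 1) M) in Pz.
  apply Rabs_def2 in Pz.
  assert (E : RInt f a (M - 1) + RInt f (M - 1) M + RInt f M b = RInt f a b).
  { rewrite <- (RInt_Chasles f a M b) by (now apply continuous_ex_RInt).
    now rewrite <- (RInt_Chasles f a (M - 1) M) by (now apply continuous_ex_RInt). }
  assert (0 <= RInt f a (M - 1)).
  { apply RInt_ge_0; try lra. now apply continuous_ex_RInt. auto. }
  assert (0 <= RInt f M b).
  { apply RInt_ge_0; try lra. now apply continuous_ex_RInt. auto. }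
  lra.
Qed.

(** * Polynomials in y and the logistic function *)

Definition logis (y : R) : R := / (1 + exp (- y)).
Definition dlogis (y : R) : R := logis y * (1 - logis y).

Lemma logis_bound (y : R) : 0 < logis y < 1.
Proof.
  unfold logis. generalize (exp_pos (- y)); intros H. split.
  - apply Rinv_0_lt_compat; lra.
  - rewrite <- Rinv_1 at 2. apply Rinv_lt_contravar; lra.
Qed.

Lemma dlogis_pos (y : R) : 0 < dlogis y.
Proof. unfold dlogis. generalize (logis_bound y); nra. Qed.

Lemma logis_le_exp (y : R) : logis y <= exp y.
Proof.
  unfold logis. rewrite exp_Ropp. generalize (exp_pos y); intros H.
  replace (/ (1 + / exp y)) with (exp y / (1 + exp y)) by (field; lra).
  apply Rle_div_l; nra.
Qed.

Lemma one_minus_logis (y : R) : 1 - logis y = logis (- y).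
Proof.
  unfold logis. rewrite Ropp_involutive, exp_Ropp. generalize (exp_pos y); intros H.
  field; lra.
Qed.

Lemma is_derive_logis (y : R) : is_derive logis y (dlogis y).
Proof.
  unfold dlogis, logis. generalize (exp_pos (- y)); intros H.
  auto_derive. lra. field; lra.
Qed.

Lemma Derive_logis (y : R) : Derive (fun x : R => logis x) y = dlogis y.
Proof. apply (is_derive_unique logis), is_derive_logis. Qed.

Lemma filterlim_logis_m : filterlim logis (Rbar_locally m_infty) (locally 0).
Proof.
  apply filterlim_locally. intros eps. exists (ln eps). intros x Hx.
  apply exp_increasing in Hx. rewrite exp_ln in Hx by apply cond_pos.
  change (Rabs (logis x - 0) < eps).
  generalize (logis_bound x) (logis_le_exp x); intros. apply Rabs_def1; lra.
Qed.

Lemma filterlim_logis_p : filterlim logis (Rbar_locally p_infty) (locally 1).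
Proof.
  apply filterlim_locally. intros eps. exists (- ln eps). intros x Hx.
  assert (Hx' : - x < ln eps) by lra.
  apply exp_increasing in Hx'. rewrite exp_ln in Hx' by apply cond_pos.
  change (Rabs (logis x - 1) < eps).
  generalize (logis_bound x) (logis_le_exp (- x)) (one_minus_logis x); intros.
  apply Rabs_def1; lra.
Qed.

Lemma exp_INR_mult (n : nat) (x : R) : exp (INR n * x) = exp x ^ n.
Proof.
  induction n as [| n IH]; [now rewrite Rmult_0_l, exp_0 |].
  rewrite S_INR, Rmult_plus_distr_r, exp_plus, IH, Rmult_1_l. simpl; ring.
Qed.

(** For a > 0, raise z <= exp z to the power a with z = |y| / a; this gives C = a^a. *)
Lemma pow_le_exp (a : nat) : exists C : R, forall y : R, Rabs y ^ a <= C * exp (Rabs y).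
Proof.
  destruct a as [| a].
  - exists 1. intros y. simpl. generalize (exp_ineq1_le (Rabs y)) (Rabs_pos y); lra.
  - exists (INR (S a) ^ S a). intros y.
    assert (H : 0 < INR (S a)) by (apply lt_0_INR; lia).
    replace (Rabs y) with (INR (S a) * (Rabs y / INR (S a))) at 1 by (field; lra).
    rewrite Rpow_mult_distr. apply Rmult_le_compat_l. apply pow_le; lra.
    replace (Rabs y) with (INR (S a) * (Rabs y / INR (S a))) at 2 by (field; lra).
    rewrite exp_INR_mult.
    apply pow_incr. split.
    + apply Rdiv_le_0_compat; [apply Rabs_pos | lra].
    + generalize (exp_ineq1_le (Rabs y / INR (S a))); lra.
Qed.

(** [dlogis y] is the product of [logis y] and [logis (- y)]; both are below 1, and one of them is
    at most exp (- |y|). *)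
Lemma dlogis_le_exp (y : R) : dlogis y * exp (Rabs y) <= 1.
Proof.
  assert (H : dlogis y <= exp (- Rabs y)).
  { unfold dlogis. generalize (logis_bound y) (logis_le_exp y) (logis_le_exp (- y)); intros.
    rewrite <- (one_minus_logis y) in *.
    unfold Rabs; destruct Rcase_abs; [rewrite Ropp_involutive |]; nra. }
  apply (Rmult_le_compat_r (exp (Rabs y))) in H. 2: left; apply exp_pos.
  now rewrite <- exp_plus, Rplus_opp_l, exp_0 in H.
Qed.

(** With U = [logis] and Ut = [dlogis], this is the span of the functions y^a U^b Ut. It is stable
    under differentiation and under multiplication by y and by U, and its members are bounded, so
    all of them are Schwartz functions. The constructor [lp_ext] closes the class under pointwise
    equality, so that functions need not be equal as terms. *)
Inductive logis_poly : (R -> R) -> Prop :=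
| lp_mono (a b : nat) : logis_poly (fun y => y ^ a * logis y ^ b * dlogis y)
| lp_lin (f g : R -> R) (c d : R) :
    logis_poly f -> logis_poly g -> logis_poly (fun y => c * f y + d * g y)
| lp_ext (f g : R -> R) : (forall y, f y = g y) -> logis_poly f -> logis_poly g.

Lemma lp_dlogis : logis_poly dlogis.
Proof. apply (lp_ext (fun y => y ^ 0 * logis y ^ 0 * dlogis y)); [intros; simpl; ring | apply lp_mono]. Qed.

Lemma lp_scal (c : R) (f : R -> R) : logis_poly f -> logis_poly (fun y => c * f y).
Proof. intros H. apply (lp_ext (fun y => c * f y + 0 * f y)); [intros; simpl; ring | now apply lp_lin]. Qed.

Lemma lp_mul_pow (j : nat) (f : R -> R) : logis_poly f -> logis_poly (fun y => y ^ j * f y).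
Proof.
  intros H; induction H as [a b | f g c d _ IHf _ IHg | f g E _ IHf].
  - apply (lp_ext (fun y => y ^ (j + a) * logis y ^ b * dlogis y)); [| apply lp_mono].
    intros y. rewrite pow_add. ring.
  - apply (lp_ext (fun y => c * (y ^ j * f y) + d * (y ^ j * g y))); [intros; ring | now apply lp_lin].
  - apply (lp_ext (fun y => y ^ j * f y)); auto. intros y. now rewrite E.
Qed.

Lemma lp_mul_logis (f : R -> R) : logis_poly f -> logis_poly (fun y => logis y * f y).
Proof.
  intros H; induction H as [a b | f g c d _ IHf _ IHg | f g E _ IHf].
  - apply (lp_ext (fun y => y ^ a * logis y ^ (S b) * dlogis y)); [| apply lp_mono].
    intros y. simpl. ring.
  - apply (lp_ext (fun y => c * (logis y * f y) + d * (logis y * g y))); [intros; ring | now apply lp_lin].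
  - apply (lp_ext (fun y => logis y * f y)); auto. intros y. now rewrite E.
Qed.

Lemma lp_derive (f : R -> R) :
  logis_poly f -> exists g : R -> R, logis_poly g /\ forall y, is_derive f y (g y).
Proof.
  intros H; induction H as [a b | f g c d _ IHf _ IHg | f g E _ IHf].
  (* From U' = Ut = U (1 - U) one gets (U^b Ut)' = (b + 1) U^b Ut - (b + 2) U^(b+1) Ut. The value
     [pred 0] is harmless, since its coefficient is INR 0. *)
  - exists (fun y => INR a * (y ^ pred a * logis y ^ b * dlogis y) +
      1 * (INR (b + 1) * (y ^ a * logis y ^ b * dlogis y) +
           - INR (b + 2) * (y ^ a * logis y ^ S b * dlogis y))).
    split.
    { apply (lp_lin (fun y => y ^ pred a * logis y ^ b * dlogis y)). apply lp_mono.
      apply lp_lin; apply lp_mono. }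
    intros y. unfold dlogis at 1.
    assert (D : ex_derive logis y) by (eexists; apply is_derive_logis).
    auto_derive; [tauto |].
    rewrite Derive_logis, !plus_INR.
    unfold dlogis. destruct b; [simpl | rewrite !S_INR; simpl]; ring.
  - destruct IHf as [f' [Hf' Df]], IHg as [g' [Hg' Dg]].
    exists (fun y => c * f' y + d * g' y). split. now apply lp_lin.
    intros y. apply (is_derive_plus (fun y => c * f y) (fun y => d * g y));
      now apply is_derive_scal.
  - destruct IHf as [f' [Hf' Df]]. exists f'; split; auto.
    intros y. now apply (is_derive_ext f).
Qed.

Lemma lp_bounded (f : R -> R) : logis_poly f -> exists C : R, forall y, Rabs (f y) <= C.
Proof.
  intros H; induction H as [a b | f g c d _ [C IHf] _ [D IHg] | f g E _ [C IHf]].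
  - destruct (pow_le_exp a) as [C HC]. exists C. intros y.
    generalize (logis_bound y) (dlogis_pos y) (dlogis_le_exp y) (HC y) (exp_pos (Rabs y)); intros.
    rewrite !Rabs_mult, <- !RPow_abs, (Rabs_pos_eq (dlogis y)), (Rabs_pos_eq (logis y)) by lra.
    assert (logis y ^ b <= 1).
    { rewrite <- (pow1 b). apply pow_incr; lra. }
    assert (0 <= logis y ^ b) by (apply pow_le; lra).
    assert (0 <= Rabs y ^ a) by (apply pow_le, Rabs_pos).
    assert (0 <= C).
    { apply Rmult_le_reg_r with (exp (Rabs y)); lra. }
    apply Rle_trans with (C * exp (Rabs y) * 1 * dlogis y).
    + apply Rmult_le_compat_r. lra. apply Rmult_le_compat; auto.
    + apply Rle_trans with (C * (dlogis y * exp (Rabs y))). right; ring.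
      rewrite <- (Rmult_1_r C) at 2. now apply Rmult_le_compat_l.
  - exists (Rabs c * C + Rabs d * D). intros y.
    eapply Rle_trans. apply Rabs_triang. rewrite !Rabs_mult.
    apply Rplus_le_compat; apply Rmult_le_compat_l; auto; apply Rabs_pos.
  - exists C. intros y. rewrite <- E. auto.
Qed.

Lemma lp_continuous (f : R -> R) (y : R) : logis_poly f -> continuous f y.
Proof.
  intros H. destruct (lp_derive f H) as [g [_ Hg]].
  apply (ex_derive_continuous f). now exists (g y).
Qed.

(** The product (1 + y^2) f is again in the class, hence bounded. *)
Lemma lp_decay (f : R -> R) : logis_poly f -> exists C, forall y, Rabs (f y) <= C * / (1 + y ^ 2).
Proof.
  intros H. destruct (lp_bounded (fun y => 1 * f y + 1 * (y ^ 2 * f y))) as [C HC].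
  { apply lp_lin; auto. now apply lp_mul_pow. }
  exists C. intros y. specialize (HC y).
  apply Rle_div_r; [nra |].
  rewrite <- (Rabs_pos_eq (1 + y ^ 2)), <- Rabs_mult by nra.
  eapply Rle_trans; [right | apply HC]. f_equal. ring.
Qed.

Lemma lp_dominated (f : R -> R) : logis_poly f -> dominated f.
Proof. intros H; split. intros; now apply lp_continuous. now apply lp_decay. Qed.

Lemma Int_R_lp (f : R -> R) : logis_poly f -> is_int_R f (Int_R f).
Proof. intros H. now apply dominated_integrable, lp_dominated. Qed.

Lemma lp_Derive_n (f : R -> R) (n : nat) :
  logis_poly f -> exists g : R -> R, logis_poly g /\
    forall y, ex_derive_n f n y /\ Derive_n f n y = g y.
Proof.
  intros H. induction n as [| n [g [Hg E]]].
  - exists f. simpl; auto.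
  - destruct (lp_derive g Hg) as [g' [Hg' D]]. exists g'. split; auto.
    intros y.
    assert (D' : is_derive (Derive_n f n) y (g' y)).
    { apply (is_derive_ext g); auto. intros t. symmetry. apply E. }
    split. now exists (g' y). now apply is_derive_unique.
Qed.

Lemma lp_schwartz (f : R -> R) : logis_poly f -> schwartz f.
Proof.
  intros H. split.
  - intros n x. destruct (lp_Derive_n f n H) as [g [_ E]]. apply E.
  - intros m n. destruct (lp_Derive_n f n H) as [g [Hg E]].
    destruct (lp_bounded (fun y => y ^ m * g y)) as [C HC]. now apply lp_mul_pow.
    exists C. intros x. destruct (E x) as [_ ->]. apply HC.
Qed.

Lemma is_int_R_dlogis : is_int_R dlogis 1.
Proof.
  unfold is_int_R. replace 1 with (1 - 0) by ring.
  apply is_RInt_gen_of_primitive with logis; try apply Rbar_locally_filter.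
  - intros; apply lp_continuous, lp_dlogis.
  - apply is_derive_logis.
  - apply filterlim_logis_m.
  - apply filterlim_logis_p.
Qed.

(** The primitive is U^2 / 2. This value normalises [St], whose integral will be prescribed as twice
    this one. *)
Lemma is_int_R_logis_dlogis : is_int_R (fun y => logis y * dlogis y) (/ 2).
Proof.
  unfold is_int_R. replace (/ 2) with (/ 2 * (1 * 1) - / 2 * (0 * 0)) by ring.
  apply is_RInt_gen_of_primitive with (fun y => / 2 * (logis y * logis y));
    try apply Rbar_locally_filter.
  - intros; apply lp_continuous, lp_mul_logis, lp_dlogis.
  - intros y. assert (D : ex_derive logis y) by (eexists; apply is_derive_logis).
    auto_derive; [tauto |].
    rewrite Derive_logis. field.
  - apply (filterlim_comp _ _ _ logis (fun z => / 2 * (z * z)) _ (locally 0)).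
    apply filterlim_logis_m.
    apply (ex_derive_continuous (fun z => / 2 * (z * z)) 0). auto_derive; auto.
  - apply (filterlim_comp _ _ _ logis (fun z => / 2 * (z * z)) _ (locally 1)).
    apply filterlim_logis_p.
    apply (ex_derive_continuous (fun z => / 2 * (z * z)) 1). auto_derive; auto.
Qed.

(** * Asymptotic expansion of the weak residuals *)

(** The derivative of order n + 1 is bounded on the whole line, so the Lagrange remainder is
    controlled by one C for all x and h; its factorial is estimated by 1. *)
Lemma taylor_bound (f : R -> R) (n : nat) :
  schwartz f -> exists C : R, forall x h : R,
    Rabs (f (x + h) - sum_f_R0 (fun m => h ^ m / INR (fact m) * Derive_n f m x) n)
      <= C * Rabs h ^ S n.
Proof.
  intros [Hd Hb]. destruct (Hb 0%nat (S n)) as [C HC].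
  assert (HC' : forall x, Rabs (Derive_n f (S n) x) <= C).
  { intros x. generalize (HC x). now rewrite pow_O, Rmult_1_l. }
  exists C. intros x h.
  assert (Hfact : forall m, 1 <= INR (fact m)).
  { intros m. apply (le_INR 1), lt_O_fact. }
  assert (Hrem : forall z d, Rabs z <= C -> Rabs d = Rabs h ->
            Rabs (d ^ S n / INR (fact (S n)) * z) <= C * Rabs h ^ S n).
  { intros z d Hz Hdh. unfold Rdiv.
    rewrite !Rabs_mult, <- RPow_abs, Hdh, (Rabs_pos_eq (/ _)).
    2: left; apply Rinv_0_lt_compat; generalize (Hfact (S n)); lra.
    assert (0 <= Rabs h ^ S n) by (apply pow_le, Rabs_pos).
    assert (/ INR (fact (S n)) <= 1).
    { rewrite <- Rinv_1. apply Rinv_le_contravar. lra. apply Hfact. }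
    assert (0 <= / INR (fact (S n))).
    { left; apply Rinv_0_lt_compat; generalize (Hfact (S n)); lra. }
    rewrite (Rmult_comm C). apply Rmult_le_compat; auto using Rabs_pos.
    - now apply Rmult_le_pos.
    - rewrite <- (Rmult_1_r (Rabs h ^ S n)) at 2. now apply Rmult_le_compat_l. }
  destruct (Rtotal_order 0 h) as [h0 | [<- | h0]].
  - destruct (Taylor_Lagrange f n x (x + h)) as [zeta [_ E]]; auto. lra.
    rewrite E. replace (x + h - x) with h by ring.
    rewrite Rplus_minus_l. auto.
  - rewrite Rplus_0_r.
    assert (E : sum_f_R0 (fun m => 0 ^ m / INR (fact m) * Derive_n f m x) n = f x).
    { clear. induction n as [| n IH].
      - simpl. field.
      - rewrite tech5, IH, pow_i by lia. unfold Rdiv. ring. }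
    rewrite E, Rminus_diag, Rabs_R0. apply Rmult_le_pos.
    + apply Rle_trans with (2 := HC' 0), Rabs_pos.
    + apply pow_le; lra.
  (* For h < 0, expand the reflection y -> f (- y) to the right of - x; the signs (-1)^m of (- h)^m
     and of the m-th derivative cancel. *)
  - destruct (Taylor_Lagrange (fun y => f (- y)) n (- x) (- (x + h))) as [zeta [_ E]].
    + lra.
    + intros t _ m _. apply ex_derive_n_comp_opp. apply filter_forall; auto.
    + rewrite Ropp_involutive in E. rewrite E.
      replace (- (x + h) - - x) with (- h) by ring.
      rewrite (sum_eq _ (fun m => h ^ m / INR (fact m) * Derive_n f m x)).
      * rewrite Rplus_minus_l. apply Hrem; [| apply Rabs_Ropp].
        rewrite Derive_n_comp_opp by (apply filter_forall; auto).
        rewrite Rabs_mult, pow_1_abs, Rmult_1_l. auto.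
      * intros m _. rewrite Derive_n_comp_opp by (apply filter_forall; auto).
        rewrite Ropp_involutive. unfold Rdiv.
        replace (- h) with ((-1) * h) by ring. rewrite Rpow_mult_distr.
        replace ((-1) ^ m * h ^ m * / INR (fact m) * ((-1) ^ m * Derive_n f m x))
          with (((-1) ^ m * (-1) ^ m) * (h ^ m * / INR (fact m) * Derive_n f m x)) by ring.
        rewrite <- Rpow_mult_distr. replace ((-1) * (-1)) with 1 by ring.
        rewrite pow1. ring.
Qed.

(** Prepend a zero coefficient; the estimate at order N + 1 is then the old one at order N. *)
Lemma expansion_from_pred (p : Z) (I : R -> R) :
  expansion_from (p + 1) I -> expansion_from p I.
Proof.
  intros [xi H]. exists (fun n => match n with O => 0 | S m => xi m end).
  intros [| N].
  (* At order 0 the new sum is zero, so the term xi 0 * e^(p+1) joins the remainder, and e <= d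
     absorbs the surplus power of e in the old bound. *)
  - destruct (H 0%nat) as [d [C [d0 HC]]].
    exists d, (C * d + Rabs (xi O)). split; auto. intros e He.
    specialize (HC e He). simpl in HC |- *.
    rewrite !Z.add_0_r in HC.
    rewrite Rmult_0_l, Rminus_0_r, Z.add_0_r.
    rewrite (powerRZ_add e (p + 1) 1) in HC by lra. simpl in HC.
    assert (P0 : 0 < powerRZ e (p + 1)) by (apply powerRZ_lt; lra).
    replace (I e) with ((I e - xi 0%nat * powerRZ e (p + 1)) + xi 0%nat * powerRZ e (p + 1)) by ring.
    eapply Rle_trans. apply Rabs_triang.
    rewrite Rabs_mult, (Rabs_pos_eq (powerRZ e (p + 1))), Rmult_plus_distr_r by lra.
    apply Rplus_le_compat_r. eapply Rle_trans. apply HC.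
    assert (C0 : 0 <= C).
    { apply Rmult_le_reg_r with (powerRZ e (p + 1) * (e * 1)).
      apply Rmult_lt_0_compat; lra.
      rewrite Rmult_0_l. eapply Rle_trans with (2 := HC), Rabs_pos. }
    replace (C * (powerRZ e (p + 1) * (e * 1))) with (C * e * powerRZ e (p + 1)) by ring.
    apply Rmult_le_compat_r. lra. apply Rmult_le_compat_l; lra.
  - destruct (H N) as [d [C [d0 HC]]]. exists d, C. split; auto. intros e He.
    specialize (HC e He).
    rewrite decomp_sum by lia. rewrite Rmult_0_l, Rplus_0_l. simpl pred.
    replace (p + Z.of_nat (S N) + 1)%Z with (p + 1 + Z.of_nat N + 1)%Z by lia.
    rewrite (sum_eq _ (fun n => xi n * powerRZ e (p + 1 + Z.of_nat n))).
    exact HC.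
    intros i _. do 2 f_equal. lia.
Qed.

Lemma expansion_from_weaken (p : Z) (n : nat) (I : R -> R) :
  expansion_from (p + Z.of_nat n) I -> expansion_from p I.
Proof.
  revert p. induction n as [| n IH]; intros p H.
  - now rewrite Z.add_0_r in H.
  - apply expansion_from_pred, IH. now replace (p + 1 + Z.of_nat n)%Z with (p + Z.of_nat (S n))%Z by lia.
Qed.

Lemma sum_f_R0_drop (a : nat -> R) (P N : nat) :
  (forall m, (m < P)%nat -> a m = 0) ->
  sum_f_R0 a (P + N) = sum_f_R0 (fun n => a (P + n)%nat) N.
Proof.
  intros H. induction N as [| N IH].
  - rewrite Nat.add_0_r. simpl. rewrite Nat.add_0_r.
    destruct P as [| P]; [reflexivity |].
    rewrite tech5, sum_eq_R0; [ring |]. intros; apply H; lia.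
  - rewrite Nat.add_succ_r, !tech5, IH, Nat.add_succ_r. reflexivity.
Qed.

Lemma is_int_R_sum (f : nat -> R -> R) (l : nat -> R) (n : nat) :
  (forall m, is_int_R (f m) (l m)) ->
  is_int_R (fun y => sum_f_R0 (fun m => f m y) n) (sum_f_R0 l n).
Proof.
  intros H. induction n as [| n IH]; [apply H |].
  rewrite tech5. apply (is_int_R_ext (fun y => 1 * sum_f_R0 (fun m => f m y) n + 1 * f (S n) y)).
  - intros y. rewrite tech5. ring.
  - rewrite <- (Rmult_1_l (sum_f_R0 l n)), <- (Rmult_1_l (l (S n))).
    now apply is_int_R_lin.
Qed.

Lemma schwartz_bounded (psi : R -> R) : schwartz psi -> exists C, forall x, Rabs (psi x) <= C.
Proof.
  intros [_ H]. destruct (H 0%nat 0%nat) as [C HC]. exists C. intros x.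
  generalize (HC x). simpl. now rewrite Rmult_1_l.
Qed.

Lemma schwartz_continuous (psi : R -> R) (x : R) : schwartz psi -> continuous psi x.
Proof. intros [H _]. apply (ex_derive_continuous psi), (H 1%nat). Qed.

Lemma dominated_mul_schwartz (f psi : R -> R) (c e : R) :
  dominated f -> schwartz psi -> dominated (fun y => f y * psi (c + e * y)).
Proof.
  intros [Hc [C HC]] Hpsi. split.
  - intros x. apply (continuous_mult f (fun y => psi (c + e * y))). apply Hc.
    apply (continuous_comp (fun y => c + e * y) psi).
    + apply (ex_derive_continuous (fun y => c + e * y)). auto_derive; auto.
    + now apply schwartz_continuous.
  - destruct (schwartz_bounded psi Hpsi) as [D HD]. exists (C * D). intros x.
    rewrite Rabs_mult. apply Rle_trans with ((C * / (1 + x ^ 2)) * D).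
    + apply Rmult_le_compat; auto using Rabs_pos.
    + right; ring.
Qed.

Lemma dominated_inv : dominated (fun x => / (1 + x ^ 2)).
Proof.
  split.
  - intros x. apply (ex_derive_continuous (fun x => / (1 + x ^ 2))). auto_derive. nra.
  - exists 1. intros x. rewrite Rabs_pos_eq. lra. left; apply Rinv_0_lt_compat; nra.
Qed.

(** Replace psi (c + e y) by its Taylor polynomial of degree M = P + N in e y. The term of degree m
    integrates to [a m * e ^ m], which vanishes for m < P. The remainder is at most C e^(M+1)
    |y^(M+1) F(y)|, and the decay of F makes its integral O(e^(M+1)). *)
Lemma moment_expansion (F psi : R -> R) (P : nat) (c : R) :
  logis_poly F -> (forall j, (j < P)%nat -> is_int_R (fun y => y ^ j * F y) 0) ->
  schwartz psi ->
  expansion_from (Z.of_nat P) (fun e => Int_R (fun y => F y * psi (c + e * y))).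
Proof.
  intros HF Hmom Hpsi.
  pose (mu := fun m => Int_R (fun y => y ^ m * F y)).
  assert (Hmu : forall m, is_int_R (fun y => y ^ m * F y) (mu m)).
  { intros m. now apply dominated_integrable, lp_dominated, lp_mul_pow. }
  pose (a := fun m => Derive_n psi m c / INR (fact m) * mu m).
  exists (fun n => a (P + n)%nat). intros N.
  set (M := (P + N)%nat).
  destruct (taylor_bound psi M Hpsi) as [C HC].
  destruct (lp_decay (fun y => y ^ S M * F y)) as [D HD]. now apply lp_mul_pow.
  pose (K := Int_R (fun y => / (1 + y ^ 2))).
  assert (HK : is_int_R (fun y => / (1 + y ^ 2)) K) by apply dominated_integrable, dominated_inv.
  (* C comes from the Taylor remainder, D from the decay of y^(M+1) F, and K is the integral of 1 /
     (1 + y^2); none depends on e. *)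
  exists 1, (C * D * K). split. lra. intros e He.
  assert (E : sum_f_R0 (fun n => a (P + n)%nat * powerRZ e (Z.of_nat P + Z.of_nat n)) N =
              sum_f_R0 (fun m => a m * e ^ m) M).
  { unfold M. rewrite (sum_f_R0_drop (fun m => a m * e ^ m)).
    - apply sum_eq. intros i _. now rewrite <- Nat2Z.inj_add, <- pow_powerRZ.
    - intros m Hm. unfold a. rewrite (is_int_R_unique _ _ _ (Hmu m) (Hmom m Hm)). ring. }
  rewrite E.
  replace (Z.of_nat P + Z.of_nat N + 1)%Z with (Z.of_nat (S M)) by (unfold M; lia).
  rewrite <- pow_powerRZ.
  assert (HI : is_int_R (fun y => F y * psi (c + e * y)) (Int_R (fun y => F y * psi (c + e * y)))).
  { apply dominated_integrable, dominated_mul_schwartz; auto. now apply lp_dominated. }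
  assert (HS : is_int_R
    (fun y => sum_f_R0 (fun m => Derive_n psi m c / INR (fact m) * e ^ m * (y ^ m * F y)) M)
    (sum_f_R0 (fun m => a m * e ^ m) M)).
  { rewrite (sum_eq _ (fun m => Derive_n psi m c / INR (fact m) * e ^ m * mu m)).
    2:{ intros; unfold a; ring. }
    apply (is_int_R_sum (fun m y => Derive_n psi m c / INR (fact m) * e ^ m * (y ^ m * F y))).
    intros m. apply (is_int_R_scal (fun y => y ^ m * F y)), Hmu. }
  replace (_ - _) with (1 * Int_R (fun y => F y * psi (c + e * y)) +
    (-1) * sum_f_R0 (fun m => a m * e ^ m) M) by ring.
  replace (C * D * K * e ^ S M) with (C * D * e ^ S M * K) by ring.
  eapply is_int_R_Rabs_le; [| apply is_int_R_lin; [apply HI | apply HS] |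
    apply (is_int_R_scal (fun y => / (1 + y ^ 2)) (C * D * e ^ S M)), HK].
  intros y. simpl.
  replace (sum_f_R0 _ M) with (F y * sum_f_R0
     (fun m => (e * y) ^ m / INR (fact m) * Derive_n psi m c) M).
  2:{ rewrite scal_sum. apply sum_eq. intros m _. rewrite Rpow_mult_distr. unfold Rdiv. ring. }
  set (s := sum_f_R0 _ M).
  replace (1 * _ + _) with (F y * (psi (c + e * y) - s)) by ring.
  rewrite Rabs_mult.
  apply Rle_trans with (Rabs (F y) * (C * Rabs (e * y) ^ S M)).
  { apply Rmult_le_compat_l. apply Rabs_pos. apply HC. }
  assert (C0 : 0 <= C).
  { generalize (HC 0 1) (Rabs_pos (psi (0 + 1) - sum_f_R0 (fun m => 1 ^ m / INR (fact m) * Derive_n psi m 0) M)).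
    rewrite Rabs_R1, pow1. lra. }
  rewrite Rabs_mult, Rpow_mult_distr, (Rabs_pos_eq e) by lra.
  replace (Rabs (F y) * (C * (e ^ S M * Rabs y ^ S M)))
    with (C * e ^ S M * Rabs (y ^ S M * F y)) by (rewrite Rabs_mult, RPow_abs; ring).
  apply Rle_trans with (C * e ^ S M * (D * / (1 + y ^ 2))).
  { apply Rmult_le_compat_l; [| apply HD]. apply Rmult_le_pos; auto. apply pow_le; lra. }
  right. simpl. ring.
Qed.

(** * Solving the moment conditions *)

Inductive span (g : nat -> R -> R) (n : nat) : (R -> R) -> Prop :=
| span_0 : span g n (fun _ => 0)
| span_gen (i : nat) : (i < n)%nat -> span g n (g i)
| span_lin (f h : R -> R) (c d : R) :
    span g n f -> span g n h -> span g n (fun y => c * f y + d * h y).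

Lemma span_le (g : nat -> R -> R) (m n : nat) (h : R -> R) :
  (m <= n)%nat -> span g m h -> span g n h.
Proof.
  intros mn H. induction H.
  - apply span_0.
  - apply span_gen; lia.
  - now apply span_lin.
Qed.

(* On y <= -1, h = O(g / |y|); the bound survives linear combinations. *)
Definition dominates_m (g h : R -> R) : Prop :=
  exists C : R, forall y : R, y <= -1 -> Rabs y * Rabs (h y) <= C * Rabs (g y).

Lemma dominates_m_span (g : nat -> R -> R) (n : nat) (h : R -> R) :
  (forall i, (i < n)%nat -> dominates_m (g n) (g i)) -> span g n h -> dominates_m (g n) h.
Proof.
  intros Hg H. induction H as [| i Hi | f h c d _ [C IHf] _ [D IHh]].
  - exists 0. intros y _. rewrite Rabs_R0. lra.
  - auto.
  - exists (Rabs c * C + Rabs d * D). intros y Hy.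
    apply Rle_trans with (Rabs c * (Rabs y * Rabs (f y)) + Rabs d * (Rabs y * Rabs (h y))).
    + generalize (Rabs_triang (c * f y) (d * h y)). rewrite !Rabs_mult. intros T.
      apply (Rmult_le_compat_l (Rabs y)) in T; [lra | apply Rabs_pos].
    + specialize (IHf y Hy). specialize (IHh y Hy).
      apply (Rmult_le_compat_l (Rabs c)) in IHf; [| apply Rabs_pos].
      apply (Rmult_le_compat_l (Rabs d)) in IHh; [| apply Rabs_pos]. lra.
Qed.

Lemma span_lp (g : nat -> R -> R) (n : nat) (h f : R -> R) :
  (forall i f, logis_poly f -> logis_poly (fun y => g i y * f y)) ->
  logis_poly f -> span g n h -> logis_poly (fun y => h y * f y).
Proof.
  intros Hg Hf H. induction H as [| i Hi | u v c d _ IHu _ IHv].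
  - apply (lp_ext (fun y => 0 * f y)). auto. now apply lp_scal.
  - auto.
  - apply (lp_ext (fun y => c * (u y * f y) + d * (v y * f y))).
    intros; ring. now apply lp_lin.
Qed.

Lemma span_orthogonal (g : nat -> R -> R) (n : nat) (h f : R -> R) :
  logis_poly f -> (forall i, (i < n)%nat -> is_int_R (fun y => g i y * f y) 0) ->
  span g n h -> is_int_R (fun y => h y * f y) 0.
Proof.
  intros Hf Hg H. induction H as [| i Hi | u v c d _ IHu _ IHv].
  - generalize (is_int_R_scal f 0 _ (Int_R_lp f Hf)). now rewrite Rmult_0_l.
  - auto.
  - replace 0 with (c * 0 + d * 0) by ring.
    apply (is_int_R_ext (fun y => c * (u y * f y) + d * (v y * f y))).
    intros; ring. now apply is_int_R_lin.
Qed.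

(** Induction on n, with the induction hypothesis used twice. Applied to the products of [g n] with
    the earlier members, it gives their projection q of [g n], so r = g n - q is orthogonal to them.
    Applied to b, it gives h0, which meets the first n conditions; a multiple of r then corrects the
    last one. *)
Lemma gram_schmidt (g : nat -> R -> R) :
  (forall i f, logis_poly f -> logis_poly (fun y => g i y * f y)) ->
  (forall i n, (i < n)%nat -> dominates_m (g n) (g i)) ->
  (forall n y, y <= -1 -> g n y <> 0) ->
  forall (n : nat) (b : nat -> R), exists h : R -> R, span g n h /\
    forall i, (i < n)%nat -> is_int_R (fun y => g i y * (h y * dlogis y)) (b i).
Proof.
  intros Hlp Hdom Hnz n. induction n as [| n IH]; intros b.
  { exists (fun _ => 0). split; [apply span_0 | lia]. }
  destruct (IH (fun i => Int_R (fun y => g i y * (g n y * dlogis y)))) as [q [Sq Hq]].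
  destruct (IH b) as [h0 [Sh0 Hh0]].
  pose (r := fun y => 1 * g n y + (-1) * q y).
  assert (Sr : span g (S n) r).
  { apply span_lin. apply span_gen; lia. apply (span_le _ n); auto. }
  assert (Lr : logis_poly (fun y => r y * dlogis y)).
  { now apply (span_lp g (S n)); [| apply lp_dlogis |]. }
  assert (Or : forall i, (i < n)%nat -> is_int_R (fun y => g i y * (r y * dlogis y)) 0).
  { intros i Hi.
    replace 0 with (1 * Int_R (fun y => g i y * (g n y * dlogis y)) +
      (-1) * Int_R (fun y => g i y * (g n y * dlogis y))) by ring.
    apply (is_int_R_ext (fun y => 1 * (g i y * (g n y * dlogis y)) + (-1) * (g i y * (q y * dlogis y)))).
    { intros; unfold r; ring. }
    apply is_int_R_lin; [| now apply Hq].
    apply Int_R_lp, Hlp, Hlp, lp_dlogis. }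
  (* c is also the integral of r^2 dlogis, as r is orthogonal to q. *)
  set (c := Int_R (fun y => g n y * (r y * dlogis y))).
  assert (Hc : is_int_R (fun y => g n y * (r y * dlogis y)) c) by (apply Int_R_lp, Hlp, Lr).
  assert (c0 : 0 < c).
  (* A zero of r at y <= -1 means q y = g n y <> 0, and domination then gives |y| <= C. So r has no
     zero left of - (1 + |C|), and r^2 [dlogis] has a positive integral. *)
  { destruct (dominates_m_span g n q) as [C HC]; auto.
    apply (is_int_R_gt_0 (fun y => r y * (r y * dlogis y)) c (- (1 + Rabs C))).
    - intros y. apply lp_continuous. now apply (span_lp g (S n)).
    - intros y. generalize (dlogis_pos y) (Rle_0_sqr (r y)). unfold Rsqr. nra.
    - intros y Hy. generalize (Rabs_pos C) (Rle_abs C); intros.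
      assert (y1 : y <= -1) by lra.
      assert (r y <> 0).
      { intros E. unfold r in E. assert (E' : q y = g n y) by lra.
        specialize (HC y y1). rewrite E' in HC.
        assert (0 < Rabs (g n y)) by now apply Rabs_pos_lt, Hnz.
        rewrite (Rabs_left y) in HC by lra. nra. }
      rewrite <- Rmult_assoc. apply Rmult_lt_0_compat. 2: apply dlogis_pos.
      now apply Rsqr_pos_lt.
    - replace c with (1 * c + (-1) * 0) by ring.
      apply (is_int_R_ext (fun y => 1 * (g n y * (r y * dlogis y)) + (-1) * (q y * (r y * dlogis y)))).
      { intros; unfold r; ring. }
      apply is_int_R_lin; auto. now apply (span_orthogonal g n). }
  set (m := Int_R (fun y => g n y * (h0 y * dlogis y))).
  (* Orthogonality of r leaves the conditions i < n intact; the coefficient raises the n-th integral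
     from m to b n. *)
  exists (fun y => 1 * h0 y + ((b n - m) / c) * r y). split.
  { apply span_lin; auto. apply (span_le _ n); auto. }
  intros i Hi.
  apply (is_int_R_ext (fun y => 1 * (g i y * (h0 y * dlogis y)) +
    ((b n - m) / c) * (g i y * (r y * dlogis y)))).
  { intros; ring. }
  destruct (Nat.eq_dec i n) as [-> | ne].
  - assert (Hm : is_int_R (fun y => g n y * (h0 y * dlogis y)) m).
    { apply Int_R_lp, Hlp. now apply (span_lp g n); [| apply lp_dlogis |]. }
    generalize (is_int_R_lin _ _ 1 ((b n - m) / c) _ _ Hm Hc).
    now replace (1 * m + (b n - m) / c * c) with (b n) by (field; lra).
  - generalize (is_int_R_lin _ _ 1 ((b n - m) / c) _ _ (Hh0 i ltac:(lia)) (Or i ltac:(lia))).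
    now replace (1 * b i + (b n - m) / c * 0) with (b i) by ring.
Qed.

(* Ordered so that each member outgrows the previous ones at -oo, where logis
   decays exponentially. *)
Definition mixed_family (P i : nat) (y : R) : R :=
  if (i <? P)%nat then y ^ i * logis y else y ^ (i - P).

Lemma pow_dominates (i j : nat) (y : R) :
  (i < j)%nat -> y <= -1 -> Rabs y * Rabs (y ^ i) <= Rabs (y ^ j).
Proof.
  intros ij Hy. rewrite <- !RPow_abs. change (Rabs y ^ S i <= Rabs y ^ j).
  apply Rle_pow; [| lia]. rewrite Rabs_left; lra.
Qed.

Lemma mixed_family_dominates (P i n : nat) :
  (i < n)%nat -> dominates_m (mixed_family P n) (mixed_family P i).
Proof.
  intros Hin. unfold mixed_family.
  destruct (Nat.ltb_spec i P) as [iP | iP], (Nat.ltb_spec n P) as [nP | nP]; try lia.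
  - exists 1. intros y Hy. generalize (pow_dominates i n y Hin Hy) (Rabs_pos (logis y)); intros.
    rewrite !Rabs_mult. nra.
  (* Across the two blocks: U <= exp y = exp (- |y|) bounds |y|^(i+1) U by C, while |y|^(n-P) >=
     1. *)
  - destruct (pow_le_exp (S i)) as [C HC]. exists C. intros y Hy.
    rewrite Rabs_mult, <- RPow_abs.
    replace (Rabs y * (Rabs y ^ i * Rabs (logis y))) with (Rabs y ^ S i * Rabs (logis y))
      by (simpl; ring).
    generalize (logis_bound y) (logis_le_exp y) (HC y); intros.
    rewrite (Rabs_pos_eq (logis y)) by lra.
    assert (E : exp (Rabs y) * exp y = 1).
    { rewrite <- exp_plus, Rabs_left by lra. rewrite <- exp_0. f_equal. ring. }
    assert (1 <= Rabs y ^ (n - P)).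
    { apply pow_R1_Rle. rewrite Rabs_left; lra. }
    rewrite <- RPow_abs.
    assert (0 <= Rabs y ^ S i) by apply pow_le, Rabs_pos.
    assert (0 <= C).
    { generalize (exp_pos (Rabs y)); nra. }
    apply Rle_trans with (C * exp (Rabs y) * exp y).
    + apply Rmult_le_compat; lra.
    + rewrite Rmult_assoc, E. now apply Rmult_le_compat_l.
  - exists 1. intros y Hy. rewrite Rmult_1_l. apply pow_dominates; auto. lia.
Qed.

Lemma mixed_family_neq_0 (P n : nat) (y : R) : y <= -1 -> mixed_family P n y <> 0.
Proof.
  intros Hy. unfold mixed_family. assert (Hp : forall i, y ^ i <> 0).
  { intros; apply pow_nonzero; lra. }
  destruct (n <? P)%nat; auto.
  apply Rmult_integral_contrapositive_currified; auto. generalize (logis_bound y); lra.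
Qed.

Lemma mixed_family_lp (P i : nat) (f : R -> R) :
  logis_poly f -> logis_poly (fun y => mixed_family P i y * f y).
Proof.
  intros Hf. unfold mixed_family. destruct (i <? P)%nat.
  - apply (lp_ext (fun y => y ^ i * (logis y * f y))). intros; ring.
    now apply lp_mul_pow, lp_mul_logis.
  - now apply lp_mul_pow.
Qed.

Lemma prescribed_moments (P : nat) (a b : nat -> R) :
  exists f : R -> R, logis_poly f /\
    (forall j, (j < P)%nat -> is_int_R (fun y => y ^ j * f y) (a j)) /\
    (forall j, (j < P)%nat -> is_int_R (fun y => y ^ j * (logis y * f y)) (b j)).
Proof.
  (* The members carrying the factor [logis] occupy the first P indices, so the data b come before
     a. *)
  destruct (gram_schmidt (mixed_family P) (mixed_family_lp P) (mixed_family_dominates P)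
    (mixed_family_neq_0 P) (P + P)%nat (fun i => if (i <? P)%nat then b i else a (i - P)%nat))
    as [h [Sh Hh]].
  exists (fun y => h y * dlogis y). split; [| split].
  - apply (span_lp _ _ _ _ (mixed_family_lp P) lp_dlogis Sh).
  - intros j Hj. specialize (Hh (P + j)%nat ltac:(lia)).
    unfold mixed_family in Hh.
    destruct (Nat.ltb_spec (P + j) P) as [? | _]; [lia |].
    now replace (P + j - P)%nat with j in Hh by lia.
  - intros j Hj. specialize (Hh j ltac:(lia)). unfold mixed_family in Hh.
    destruct (Nat.ltb_spec j P) as [_ | ?]; [| lia].
    revert Hh. apply is_int_R_ext. intros; ring.
Qed.

(** * Residuals of travelling waves, and the choice of profiles *)

Lemma Derive_wave (c0 d v e t x : R) (W Wt : R -> R) :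
  (forall y, is_derive W y (Wt y)) -> e <> 0 ->
  Derive (fun y => wave c0 d W v e t y) x = d * / e * Wt ((x - v * t) / e) /\
  Derive (fun s => wave c0 d W v e s x) t = - v * d * / e * Wt ((x - v * t) / e).
Proof.
  intros HW He.
  assert (D : forall y, ex_derive W y) by (intros y; now exists (Wt y)).
  assert (E : forall y, Derive (fun x : R => W x) y = Wt y).
  { intros y. now apply (is_derive_unique W). }
  split; apply is_derive_unique; unfold wave; auto_derive; auto.
  - rewrite E. field_simplify; auto.
  - rewrite E. field_simplify; auto.
Qed.

(** Substituting y = (x - c) / e removes the factor 1 / e and leaves the integral of F(y) psi (c + e
    y). Its expansion starts at the natural number P, and is then weakened to p, which may be
    negative. *)
Lemma weak_residual_profile (p : Z) (res : R -> R -> R -> R) (F psi : R -> R) (P : nat)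
  (c t : R) :
  (p <= Z.of_nat P)%Z -> logis_poly F ->
  (forall j, (j < P)%nat -> is_int_R (fun y => y ^ j * F y) 0) ->
  (forall e x, 0 < e -> res e t x = / e * F ((x - c) / e)) ->
  schwartz psi -> weak_residual_from p res t psi.
Proof.
  intros Hp HF Hmom Hres Hpsi.
  exists (fun e => Int_R (fun y => F y * psi (c + e * y))). split.
  - intros e He.
    apply (is_int_R_ext (fun x => / e * (F ((x - c) / e) * psi (c + e * ((x - c) / e))))).
    { intros x. rewrite Hres by lra. replace (c + e * ((x - c) / e)) with x by (field; lra). ring. }
    apply (is_int_R_rescale (fun y => F y * psi (c + e * y))). lra.
    apply dominated_integrable, dominated_mul_schwartz; auto. now apply lp_dominated.
  - apply (expansion_from_weaken _ (Z.to_nat (Z.of_nat P - p))).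
    replace (p + Z.of_nat (Z.to_nat (Z.of_nat P - p)))%Z with (Z.of_nat P) by lia.
    now apply moment_expansion.
Qed.

Theorem theorem4 (T : R) (hT : 0 < T) (k : R) (p : Z) :
  exists (u0 du s0 ds v : R) (Ut St U S : R -> R),
    du <> 0 /\ ds <> 0 /\
    schwartz Ut /\ schwartz St /\
    is_int_R Ut 1 /\ is_int_R St 1 /\
    is_primitive_from_minf Ut U /\ is_primitive_from_minf St S /\
    (forall t : R, 0 <= t <= T -> forall psi : R -> R, schwartz psi ->
       weak_residual_from p
         (fun eps => residual1 (wave u0 du U v eps) (wave s0 ds S v eps)) t psi /\
       weak_residual_from p
         (fun eps => residual2 k (wave u0 du U v eps) (wave s0 ds S v eps)) t psi) /\
    v = 2 * u0 + du - ds / du /\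
    ds ^ 2 - (u0 + / 2 * du) * du * ds - k ^ 2 * du ^ 2 = 0.
Proof.
  (* P is positive even for p <= 0: the condition j = 0 must be among those imposed, since it gives
     [St] its integral 1. *)
  assert (HP : exists P, (0 < P)%nat /\ (p <= Z.of_nat P)%Z) by (exists (S (Z.to_nat p)); lia).
  destruct HP as [P [P0 HP]].
  set (m := fun j => Int_R (fun y => y ^ j * dlogis y)).
  set (n := fun j => Int_R (fun y => y ^ j * (logis y * dlogis y))).
  assert (Lw := lp_dlogis).
  assert (LUw := lp_mul_logis _ Lw).
  assert (Hm : forall j, is_int_R (fun y => y ^ j * dlogis y) (m j)).
  { intros j. now apply Int_R_lp, lp_mul_pow. }
  assert (Hn : forall j, is_int_R (fun y => y ^ j * (logis y * dlogis y)) (n j)).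
  { intros j. now apply Int_R_lp, lp_mul_pow. }
  (* The first prescription cancels the moments of 2 U Ut - St. Given it, the second cancels those
     of (k^2 - 1/2 + U) St - k^2 Ut. *)
  destruct (prescribed_moments P (fun j => 2 * n j)
    (fun j => k ^ 2 * m j - (k ^ 2 - / 2) * (2 * n j))) as [St [LS [H1 H2]]].
  destruct (dominated_primitive St (lp_dominated St LS)) as [S [HS DS]].
  (* With du = ds = 1 the quadratic relation reads 1 - (u0 + 1/2) - k^2 = 0, which fixes u0, and the
     speed is v = 2 u0. *)
  exists (/ 2 - k ^ 2), 1, 0, 1, (1 - 2 * k ^ 2), dlogis, St, logis, S.
  repeat split; try lra; try (now apply lp_schwartz).
  - apply is_int_R_dlogis.
  - replace 1 with (2 * n 0%nat).
    + apply (is_int_R_ext (fun y => y ^ 0 * St y)). intros; simpl; ring. now apply H1.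
    + rewrite (is_int_R_unique _ (n 0%nat) (/ 2) (Hn 0%nat)). lra.
      apply (is_int_R_ext (fun y => logis y * dlogis y)). intros; simpl; ring.
      apply is_int_R_logis_dlogis.
  - intros x. replace (logis x) with (logis x - 0) by ring.
    apply (is_RInt_gen_of_primitive dlogis logis);
      try apply Rbar_locally_filter; try apply at_point_filter.
    + intros; now apply lp_continuous.
    + apply is_derive_logis.
    + apply filterlim_logis_m.
    + intros Q HQ. now apply locally_singleton in HQ.
  - assumption.
  (* Here - v + 2 u = 2 U, because v = 2 u0. *)
  - apply (weak_residual_profile p _ (fun y => 2 * (logis y * dlogis y) + (-1) * St y) psi P
      ((1 - 2 * k ^ 2) * t)); auto.
    + now apply lp_lin.
    + intros j Hj. replace 0 with (2 * n j + (-1) * (2 * n j)) by ring.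
      apply (is_int_R_ext (fun y => 2 * (y ^ j * (logis y * dlogis y)) + (-1) * (y ^ j * St y))).
      intros; ring. apply is_int_R_lin; auto.
    + intros e x He. unfold residual1.
      destruct (Derive_wave (/ 2 - k ^ 2) 1 (1 - 2 * k ^ 2) e t x _ _ is_derive_logis) as [-> ->]; [lra |].
      destruct (Derive_wave 0 1 (1 - 2 * k ^ 2) e t x _ _ DS) as [-> _]; [lra |].
      unfold wave. field. lra.
  (* Here the factor of St is - v + u = - u0 + U = k^2 - 1/2 + U. *)
  - apply (weak_residual_profile p _ (fun y => 1 * (logis y * St y) +
        1 * ((k ^ 2 - / 2) * St y + (- k ^ 2) * dlogis y)) psi P ((1 - 2 * k ^ 2) * t)); auto.
    + apply lp_lin. now apply lp_mul_logis. now apply lp_lin.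
    + intros j Hj.
      replace 0 with (1 * (k ^ 2 * m j - (k ^ 2 - / 2) * (2 * n j)) +
        1 * ((k ^ 2 - / 2) * (2 * n j) + (- k ^ 2) * m j)) by ring.
      apply (is_int_R_ext (fun y => 1 * (y ^ j * (logis y * St y)) +
        1 * ((k ^ 2 - / 2) * (y ^ j * St y) + (- k ^ 2) * (y ^ j * dlogis y)))).
      intros; ring. apply is_int_R_lin; auto. apply is_int_R_lin; auto.
    + intros e x He. unfold residual2.
      destruct (Derive_wave (/ 2 - k ^ 2) 1 (1 - 2 * k ^ 2) e t x _ _ is_derive_logis) as [-> _]; [lra |].
      destruct (Derive_wave 0 1 (1 - 2 * k ^ 2) e t x _ _ DS) as [-> ->]; [lra |].
      unfold wave. field. lra.
Qed.
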